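(* Let $M\in\mathcal{M}_{3,2}^{p\times q}$ and let $A^{(1)},\dots,A^{(p)},B^{(1)},\dots,B^{(q)}\in\mathcal{S}^2_+$ be a size-$2$ psd factorization of $M$. Let $A^{(1)},\dots,A^{(\bar p)},B^{(1)},\dots,B^{(\bar q)}$ be the collection of the factors that have rank one, written as $A^{(i)}=a_ia_i^T$ and $B^{(j)}=b_jb_j^T$ with $a_i,b_j\in\mathbb{R}^2$. Assume $\bar p,\bar q\ge2$, $\langle a_1,b_1\rangle=\langle a_2,b_2\rangle=0$, and $\det(a_i,a_j)\ne0$, $\det(b_i,b_j)\ne0$ for all $i\neq j$. Then the psd factorization is $2$-infinitesimally rigid if and only if $\bar p,\bar q\ge3$.
   Context: $\mathcal{S}^2$ (resp. $\mathcal{S}^2_+$) is the set of real symmetric (resp. symmetric positive semidefinite, psd) $2\times2$ matrices; $\langle X,Y\rangle=\operatorname{trace}(XY)$ for symmetric matrices, $\langle a,b\rangle=a^Tb$ for vectors; $\det(a,b)$ is the determinant of the $2\times2$ matrix with columns $a,b$. A size-$k$ psd factorization of a nonnegative $p\times q$ matrix $M$ is a tuple $A^{(1)},\dots,A^{(p)},B^{(1)},\dots,B^{(q)}$ of $k\times k$ psd matrices with $M_{ij}=\langle A^{(i)},B^{(j)}\rangle$; the psd rank of $M$ is the smallest such $k$. $\mathcal{M}_{3,2}^{p\times q}$ is the set of nonnegative $p\times q$ matrices of rank $3$ and psd rank $2$. A $2$-infinitesimal motion of a size-$2$ psd factorization is a tuple $(\dot A^{(1)},\dots,\dot A^{(p)},\dot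 B^{(1)},\dots,\dot B^{(q)})$ of matrices in $\mathcal{S}^2$ such that (1) $\langle\dot A^{(i)},B^{(j)}\rangle+\langle A^{(i)},\dot B^{(j)}\rangle=0$ for all $i,j$; and (2) there is $\varepsilon>0$ such that $A^{(i)}+t\dot A^{(i)}$ and $B^{(j)}+t\dot B^{(j)}$ are psd for all $i,j$ and all $t\in[0,\varepsilon)$. Put $\operatorname{vec}(X)=(X_{11},X_{22},\sqrt2X_{12})$ (row vector). If $M\in\mathcal{M}_{3,2}^{p\times q}$, every $2$-infinitesimal motion is given by a unique $D\in\mathbb{R}^{3\times3}$ via $\operatorname{vec}(\dot A^{(i)})=\operatorname{vec}(A^{(i)})D$ and $\operatorname{vec}(\dot B^{(j)})^T=-D\operatorname{vec}(B^{(j)})^T$. The motion is $2$-trivial if the same $D$ gives, by these formulas, a $2$-infinitesimal motion of every size-$2$ psd factorization of every matrix in $\mathcal{M}_{3,2}^{p\times q}$. A size-$2$ psd factorization of $M$ is $2$-infinitesimally rigid if all its $2$-infinitesimal motions are $2$-trivial. *)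

(* Defs.v *)
From mathcomp Require Export all_boot all_order all_algebra.
From mathcomp Require Export reals.

Set Implicit Arguments.
Unset Strict Implicit.
Unset Printing Implicit Defensive.

Import Order.TTheory GRing.Theory Num.Theory.
Local Open Scope ring_scope.

Definition psd (R : realType) (k : nat) (X : 'M[R]_k) : Prop :=
  X^T = X /\ forall v : 'cV[R]_k, 0 <= (v^T *m X *m v) 0 0.

Definition dotv (R : realType) (k : nat) (a b : 'cV[R]_k) : R :=
  (a^T *m b) 0 0.

Definition dotm (R : realType) (k : nat) (X Y : 'M[R]_k) : R :=
  \tr (X *m Y).

Definition det2 (R : realType) (a b : 'cV[R]_2) : R :=
  \det (row_mx a b : 'M[R]_2).

Definition psd_factorization (R : realType) (k p q : nat) (M : 'M[R]_(p, q))
    (A : 'I_p -> 'M[R]_k) (B : 'I_q -> 'M[R]_k) : Prop :=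
  [/\ forall i, psd (A i),
      forall j, psd (B j) &
      forall i j, M i j = dotm (A i) (B j)].

Definition has_psd_factorization (R : realType) (p q : nat)
    (M : 'M[R]_(p, q)) (k : nat) : Prop :=
  exists (A : 'I_p -> 'M[R]_k) (B : 'I_q -> 'M[R]_k), psd_factorization M A B.

Definition is_psd_rank (R : realType) (p q : nat)
    (M : 'M[R]_(p, q)) (k : nat) : Prop :=
  has_psd_factorization M k /\
  forall l : nat, has_psd_factorization M l -> (k <= l)%N.

Definition M32 (R : realType) (p q : nat) (M : 'M[R]_(p, q)) : Prop :=
  [/\ forall i j, 0 <= M i j, \rank M = 3%N & is_psd_rank M 2].

Definition inf_motion (R : realType) (p q : nat)
    (A : 'I_p -> 'M[R]_2) (B : 'I_q -> 'M[R]_2)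
    (dA : 'I_p -> 'M[R]_2) (dB : 'I_q -> 'M[R]_2) : Prop :=
  [/\ forall i, (dA i)^T = dA i,
      forall j, (dB j)^T = dB j,
      forall i j, dotm (dA i) (B j) + dotm (A i) (dB j) = 0 &
      exists2 e : R, 0 < e & forall t : R, 0 <= t -> t < e ->
        (forall i, psd (A i + t *: dA i)) /\
        (forall j, psd (B j + t *: dB j))].

Definition vec (R : realType) (X : 'M[R]_2) : 'rV[R]_3 :=
  \row_(l < 3) [:: X 0 0; X 1 1; Num.sqrt 2 * X 0 1]`_l.

Definition given_by (R : realType) (p q : nat) (D : 'M[R]_3)
    (A : 'I_p -> 'M[R]_2) (B : 'I_q -> 'M[R]_2)
    (dA : 'I_p -> 'M[R]_2) (dB : 'I_q -> 'M[R]_2) : Prop :=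
  (forall i, vec (dA i) = vec (A i) *m D) /\
  (forall j, (vec (dB j))^T = - D *m (vec (B j))^T).

(* [vec] ignores the lower-left entry, so [given_by] determines [dA] and [dB]
   only among symmetric matrices; [inf_motion] includes symmetry, hence [dA']
   and [dB'] below are the unique tuples that [D] yields from [A'] and [B'].
   When [A] and [B] factor a matrix of rank 3, [D] is unique as well. *)
Definition trivial_motion (R : realType) (p q : nat)
    (A : 'I_p -> 'M[R]_2) (B : 'I_q -> 'M[R]_2)
    (dA : 'I_p -> 'M[R]_2) (dB : 'I_q -> 'M[R]_2) : Prop :=
  exists2 D : 'M[R]_3, given_by D A B dA dB &
    forall (M' : 'M[R]_(p, q))
      (A' : 'I_p -> 'M[R]_2) (B' : 'I_q -> 'M[R]_2),
      M32 M' -> psd_factorization M' A' B' ->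
      exists (dA' : 'I_p -> 'M[R]_2) (dB' : 'I_q -> 'M[R]_2),
        given_by D A' B' dA' dB' /\ inf_motion A' B' dA' dB'.

Definition inf_rigid (R : realType) (p q : nat)
    (A : 'I_p -> 'M[R]_2) (B : 'I_q -> 'M[R]_2) : Prop :=
  forall (dA : 'I_p -> 'M[R]_2) (dB : 'I_q -> 'M[R]_2),
    inf_motion A B dA dB -> trivial_motion A B dA dB.

(* Main.v *)
Require Import Defs.
From HB Require Import structures.
From mathcomp Require Import ring lra.

Set Implicit Arguments.
Unset Strict Implicit.
Unset Printing Implicit Defensive.

Import Order.TTheory GRing.Theory Num.Theory.
Local Open Scope ring_scope.

(** A motion is governed by one linear map [L] of symmetric matrices, with
    [dA i = L (A i)] and [dB j = - L^* (B j)]. Because the perturbed factors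
    have to be psd on a straight segment, the only trivial motions are the
    scalings [L = c id]: an orthogonal pair [x], [y] in any factorization
    forces [<L (x x^T), y y^T> = 0], since this number and its opposite are
    both derivatives of a nonnegative function that vanishes at [t = 0].

    Suppose that each side has three rank-one factors. In the basis [a0], [a1]
    and its dual basis, [A i0], [A i1] and [B j1], [B j0] are multiples of
    [E_00], [E_11]. Orthogonality makes [L] diagonal in the coordinates
    [X_00], [X_11], [X_01], say with eigenvalues [c0], [c1], [c2]
    ([motion_axis], [motion_diag_scaling]). A third rank-one factor lies on the
    boundary of the cone, off the axes, so that its determinant, which starts
    at [0], must not decrease: on the A side this says [c0 + c1 >= 2 c2], and
    on the B side, where [L] acts with the opposite sign, [c0 + c1 <= 2 c2].
    The first-order terms thus vanish, the second-order term gives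
    [c0 c1 >= c2 ^ 2], and so [c0 = c1 = c2] ([axis_motion_scaling]): the
    motion is a scaling, which is a motion of every factorization.

    Conversely, suppose that one side, say B, has only the rank-one factors
    [b0], [b1]. Let [r] be the reflection that fixes [a0] and negates [a1];
    its transpose fixes [b0] and [b1] up to sign. Moving every [A i] towards
    its mirror image [r (A i) r^T] stays in the cone by convexity. The dual
    motion moves every [B j] away from its mirror image; it does not move the
    rank-one ones, and the others are zero or interior to the cone
    ([reflection_motion]). If this motion were trivial, the same [L] would give
    a motion of the factorization of the same [M] obtained by a congruence that
    takes [a0] to [a0 + a1]. The orthogonality of the first pair is preserved,
    but [r] does not preserve the line of [a0 + a1], which contradicts the
    constraint on orthogonal pairs ([reflection_not_trivial]). *)

(** * Two by two symmetric and psd matrices *)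

Lemma sum_ord2 (V : nmodType) (F : 'I_2 -> V) : \sum_(i < 2) F i = F 0 + F 1.
Proof. by rewrite !big_ord_recl big_ord0 addr0; congr (F _ + F _); apply: val_inj. Qed.

Lemma ord2_cases (i : 'I_2) : i = 0 \/ i = 1.
Proof. by case: i => [[|[|]] lti] //; [left|right]; apply: val_inj. Qed.

Lemma sym_entry (R : realType) (X : 'M[R]_2) : X^T = X -> X 1 0 = X 0 1.
Proof. by move=> sX; rewrite -{1}sX mxE. Qed.

Lemma sym_mx2P (R : realType) (X Y : 'M[R]_2) : X^T = X -> Y^T = Y ->
  X 0 0 = Y 0 0 -> X 1 1 = Y 1 1 -> X 0 1 = Y 0 1 -> X = Y.
Proof.
move=> sX sY e00 e11 e01; apply/matrixP => i j.
by case: (ord2_cases i) => ->; case: (ord2_cases j) => ->;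
  rewrite ?(sym_entry sX) ?(sym_entry sY).
Qed.

Lemma dotm_sym2 (R : realType) (X Y : 'M[R]_2) : X^T = X -> Y^T = Y ->
  dotm X Y = X 0 0 * Y 0 0 + X 1 1 * Y 1 1 + 2 * (X 0 1 * Y 0 1).
Proof.
move=> sX sY; rewrite /dotm /mxtrace sum_ord2 !mxE !sum_ord2.
by rewrite (sym_entry sX) (sym_entry sY); ring.
Qed.

Lemma quad_form2 (R : realType) (X : 'M[R]_2) (v : 'cV[R]_2) : X^T = X ->
  (v^T *m X *m v) 0 0 =
  X 0 0 * v 0 0 ^+ 2 + X 1 1 * v 1 0 ^+ 2 + 2 * (X 0 1 * v 0 0 * v 1 0).
Proof.
move=> sX; rewrite !mxE !sum_ord2 !mxE !sum_ord2 !mxE (sym_entry sX); ring.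
Qed.

Lemma det_mx2 (R : realType) (X : 'M[R]_2) :
  \det X = X 0 0 * X 1 1 - X 0 1 * X 1 0.
Proof.
rewrite (expand_det_row _ 0) sum_ord2 /cofactor !det_mx11 !mxE /= expr0 mul1r expr1.
rewrite (_ : lift 0 0 = 1); last exact: val_inj.
rewrite (_ : lift 1 0 = 0); last exact: val_inj.
ring.
Qed.

Lemma psd2P (R : realType) (X : 'M[R]_2) : psd X <->
  [/\ X^T = X, 0 <= X 0 0, 0 <= X 1 1 & X 0 1 ^+ 2 <= X 0 0 * X 1 1].
Proof.
split=> [[sX pX]|[sX X0 X1 dX]].
  have form s u : 0 <= X 0 0 * s ^+ 2 + X 1 1 * u ^+ 2 + 2 * (X 0 1 * s * u).
    have := pX (\col_i [:: s; u]`_i); rewrite (quad_form2 _ sX) !mxE /=.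
    by [].
  have X0 : 0 <= X 0 0 by have := form 1 0; lra.
  have X1 : 0 <= X 1 1 by have := form 0 1; lra.
  split=> //; rewrite -subr_ge0.
  (* The columns of the adjugate, as test vectors, give [X_11 det X] and
     [X_00 det X]; their sum decides the sign of [det X] unless [\tr X = 0]. *)
  have [tr0|trN] := eqVneq (X 0 0 + X 1 1) 0.
    have x0 : X 0 0 = 0 by lra.
    have x1 : X 1 1 = 0 by lra.
    have x01 : X 0 1 = 0 by have := form 1 1; have := form 1 (-1); lra.
    by rewrite x0 x1 x01; lra.
  have trP : 0 < X 0 0 + X 1 1 by rewrite lt_def trN addr_ge0.
  rewrite -(pmulr_rge0 _ trP).
  have := form (X 1 1) (- X 0 1); have := form (- X 0 1) (X 0 0); lra.
split=> // v; rewrite (quad_form2 _ sX).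
have [x0|xN] := eqVneq (X 0 0) 0.
  have x01 : X 0 1 = 0.
    by apply/eqP; rewrite -sqrf_eq0 eq_le sqr_ge0 andbT; move: dX; rewrite x0 mul0r.
  by rewrite x0 x01 !mul0r add0r mulr0 addr0 mulr_ge0 ?sqr_ge0.
have xP : 0 < X 0 0 by rewrite lt_def xN.
rewrite -(pmulr_rge0 _ xP).
have d0 : 0 <= X 0 0 * X 1 1 - X 0 1 ^+ 2 by rewrite subr_ge0.
have := mulr_ge0 d0 (sqr_ge0 (v 1 0)).
have := sqr_ge0 (X 0 0 * v 0 0 + X 0 1 * v 1 0).
lra.
Qed.

(** The psd cone is self-dual; in size two, this is the arithmetic-geometric
    mean inequality for the products of the diagonal entries. *)
Lemma dotm_psd_ge0 (R : realType) (X Y : 'M[R]_2) :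
  psd X -> psd Y -> 0 <= dotm X Y.
Proof.
move=> /psd2P[sX x0 x1 dX] /psd2P[sY y0 y1 dY]; rewrite dotm_sym2 //.
set s := X 0 0 * Y 0 0 + _; have s0 : 0 <= s by rewrite addr_ge0 // mulr_ge0.
have : (2 * (X 0 1 * Y 0 1)) ^+ 2 <= s ^+ 2.
  have := ler_pM (sqr_ge0 _) (sqr_ge0 _) dX dY.
  have := sqr_ge0 (X 0 0 * Y 0 0 - X 1 1 * Y 1 1); rewrite /s; lra.
by rewrite -[X in X <= _]real_normK ?num_real // ler_pXn2r ?nnegrE // => /ler_normlP[]; lra.
Qed.

Lemma psdZ (R : realType) (c : R) (X : 'M[R]_2) : 0 <= c -> psd X -> psd (c *: X).
Proof.
move=> c0 [sX pX]; split=> [|v]; first by rewrite linearZ /= sX.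
by rewrite -scalemxAr -scalemxAl mxE mulr_ge0.
Qed.

Lemma psdD (R : realType) (X Y : 'M[R]_2) : psd X -> psd Y -> psd (X + Y).
Proof.
move=> [sX pX] [sY pY]; split=> [|v]; first by rewrite linearD /= sX sY.
by rewrite mulmxDr mulmxDl mxE addr_ge0.
Qed.

Lemma det_psd_eq0_rank1 (R : realType) (X : 'M[R]_2) :
  X <> 0 -> \det X = 0 -> \rank X = 1%N.
Proof.
move=> /eqP; rewrite -mxrank_eq0 => r0 d0.
have := rank_leq_row X; rewrite leq_eqVlt => /orP[|].
  by rewrite -[_ == 2]/(row_free X) row_free_unit unitmxE d0 unitr0.
by move: r0; case: (\rank X) => [|[|]].
Qed.

(** * Congruence *)

Definition cong (R : realType) (n : nat) (g X : 'M[R]_n) := g *m X *m g^T.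

Lemma cong_is_linear (R : realType) (n : nat) (g : 'M[R]_n) : linear (cong g).
Proof. by move=> c X Y; rewrite /cong mulmxDr mulmxDl -scalemxAr -scalemxAl. Qed.

HB.instance Definition _ (R : realType) (n : nat) (g : 'M[R]_n) :=
  GRing.isLinear.Build R 'M[R]_n 'M[R]_n _ (cong g) (cong_is_linear g).

Lemma cong_cong (R : realType) (n : nat) (g h X : 'M[R]_n) :
  cong g (cong h X) = cong (g *m h) X.
Proof. by rewrite /cong trmx_mul !mulmxA. Qed.

Lemma cong1 (R : realType) (n : nat) (X : 'M[R]_n) : cong 1%:M X = X.
Proof. by rewrite /cong trmx1 mul1mx mulmx1. Qed.

Lemma congK (R : realType) (n : nat) (g : 'M[R]_n) :
  g \in unitmx -> cancel (cong g) (cong (invmx g)).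
Proof. by move=> ug X; rewrite cong_cong mulVmx // cong1. Qed.

Lemma cong_rank1 (R : realType) (n : nat) (g : 'M[R]_n) (x : 'cV[R]_n) :
  cong g (x *m x^T) = (g *m x) *m (g *m x)^T.
Proof. by rewrite /cong trmx_mul !mulmxA. Qed.

Lemma cong_sym (R : realType) (n : nat) (g X : 'M[R]_n) :
  X^T = X -> (cong g X)^T = cong g X.
Proof. by move=> sX; rewrite /cong !trmx_mul trmxK sX mulmxA. Qed.

Lemma psd_cong (R : realType) (n : nat) (g X : 'M[R]_n) :
  psd X -> psd (cong g X).
Proof.
move=> [sX pX]; split=> [|v]; first exact: cong_sym.
by have := pX (g^T *m v); rewrite /cong trmx_mul trmxK !mulmxA.
Qed.

Lemma dotmC (R : realType) (n : nat) (X Y : 'M[R]_n) : dotm X Y = dotm Y X.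
Proof. exact: mxtrace_mulC. Qed.

Lemma dotm_cong (R : realType) (n : nat) (g X Y : 'M[R]_n) :
  dotm (cong g X) Y = dotm X (cong g^T Y).
Proof. by rewrite /dotm /cong trmxK -!mulmxA mxtrace_mulC !mulmxA. Qed.

Lemma dotm_cong_contra (R : realType) (n : nat) (g X Y : 'M[R]_n) :
  g \in unitmx -> dotm (cong g X) (cong (invmx g)^T Y) = dotm X Y.
Proof.
by move=> ug; rewrite dotm_cong cong_cong -trmx_mul mulVmx // trmx1 cong1.
Qed.

(** Factorizations of one matrix come in orbits of the general linear group:
    [g] acts on one side and its inverse transpose on the other. This allows
    a choice of basis, and it supplies other factorizations of the same matrix
    on which triviality can be tested. *)
Lemma psd_factorization_cong (R : realType) (p q : nat) (M : 'M[R]_(p, q))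
    (A : 'I_p -> 'M[R]_2) (B : 'I_q -> 'M[R]_2) (g : 'M[R]_2) :
  g \in unitmx -> psd_factorization M A B ->
  psd_factorization M (fun i => cong g (A i)) (fun j => cong (invmx g)^T (B j)).
Proof.
move=> ug [pA pB MAB]; split=> [i|j|i j]; [exact: psd_cong..|].
by rewrite dotm_cong_contra.
Qed.

Lemma inf_motion_cong (R : realType) (p q : nat)
    (A dA : 'I_p -> 'M[R]_2) (B dB : 'I_q -> 'M[R]_2) (g : 'M[R]_2) :
  g \in unitmx -> inf_motion A B dA dB ->
  inf_motion (fun i => cong g (A i)) (fun j => cong (invmx g)^T (B j))
             (fun i => cong g (dA i)) (fun j => cong (invmx g)^T (dB j)).
Proof.
move=> ug [sA sB eAB [e e0 pAB]]; split=> [i|j|i j|]; [exact: cong_sym..| |].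
  by rewrite !dotm_cong_contra.
exists e => // t t0 te; have [pA pB] := pAB t t0 te.
by split=> [i|j]; rewrite -linearZ -linearD; apply: psd_cong.
Qed.

Lemma inf_motion_swap (R : realType) (p q : nat)
    (A dA : 'I_p -> 'M[R]_2) (B dB : 'I_q -> 'M[R]_2) :
  inf_motion A B dA dB -> inf_motion B A dB dA.
Proof.
move=> [sA sB eAB [e e0 pAB]]; split=> // [j i|].
  by rewrite dotmC [dotm (B j) _]dotmC addrC.
by exists e => // t t0 te; have [] := pAB t t0 te.
Qed.

(** * Constraints from orthogonal pairs of factors *)

(** When [<A i, B j> = 0], the numbers [<dA i, B j>] and [<A i, dB j>] are slopes
    at [0] of nonnegative functions that vanish there, hence nonnegative; they
    add up to [0], so both vanish. *)
Lemma motion_orthogonal (R : realType) (p q : nat)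
    (A dA : 'I_p -> 'M[R]_2) (B dB : 'I_q -> 'M[R]_2) (i : 'I_p) (j : 'I_q) :
  psd (A i) -> psd (B j) -> inf_motion A B dA dB ->
  dotm (A i) (B j) = 0 -> dotm (dA i) (B j) = 0.
Proof.
move=> pA pB [_ _ eAB [e e0 pAB]] AB0.
have t0 : 0 < e / 2 by rewrite divr_gt0.
have te : e / 2 < e by rewrite ltr_pdivrMr //; lra.
have [pAt pBt] := pAB _ (ltW t0) te.
have : 0 <= dotm (dA i) (B j).
  have := dotm_psd_ge0 (pAt i) pB.
  rewrite /dotm mulmxDl mxtraceD -scalemxAl mxtraceZ -/(dotm (A i) (B j)) AB0 add0r.
  by rewrite pmulr_rge0.
have : 0 <= dotm (A i) (dB j).
  have := dotm_psd_ge0 pA (pBt j).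
  rewrite /dotm mulmxDr mxtraceD -scalemxAr mxtraceZ -/(dotm (A i) (B j)) AB0 add0r.
  by rewrite pmulr_rge0.
by have := eAB i j; lra.
Qed.

Lemma dotm_axis (R : realType) (n : nat) (x : R) (k : 'I_n) (Y : 'M[R]_n) :
  dotm (x *: delta_mx k k) Y = x * Y k k.
Proof.
rewrite /dotm -scalemxAl mxtraceZ; congr (_ * _).
rewrite /mxtrace (bigD1 k) //= big1 ?addr0 => [|i ik].
  rewrite mxE (bigD1 k) //= big1 ?addr0 => [|j jk].
    by rewrite mxE !eqxx mul1r.
  by rewrite mxE (negbTE jk) andbF mul0r.
rewrite mxE big1 // => j _.
by rewrite mxE (negbTE ik) mul0r.
Qed.

(** A rank-one factor orthogonal to a factor of the other side can only be
    rescaled: its perturbation keeps a zero on the diagonal, and a psd matrix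
    with a zero diagonal entry has zeros in the whole row. *)
Lemma motion_axis (R : realType) (p q : nat)
    (A dA : 'I_p -> 'M[R]_2) (B dB : 'I_q -> 'M[R]_2) (i : 'I_p) (j : 'I_q)
    (k l : 'I_2) (x y : R) :
  psd (A i) -> psd (B j) -> inf_motion A B dA dB -> k != l ->
  A i = x *: delta_mx k k -> B j = y *: delta_mx l l -> y != 0 ->
  exists x', dA i = x' *: delta_mx k k.
Proof.
move=> pA pB mAB kl Ai Bj y0; exists (dA i k k).
have dll : dA i l l = 0.
  apply/eqP; rewrite -(mulrI_eq0 _ (mulfI y0)) -dotm_axis -Bj dotmC.
  apply/eqP/(motion_orthogonal pA pB mAB).
  by rewrite Ai dotm_axis Bj !mxE (negbTE kl) /= !mulr0.
case: mAB => sA _ _ [e e0 pAB].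
have t0 : 0 < e / 2 by rewrite divr_gt0.
have te : e / 2 < e by rewrite ltr_pdivrMr //; lra.
have [/(_ i) /psd2P[_ _ _] + _] := pAB _ (ltW t0) te.
rewrite Ai !mxE.
move=> minor.
have d0 : dA i 0 1 = 0.
  apply/eqP; rewrite -sqrf_eq0 eq_le sqr_ge0 andbT.
  rewrite -(pmulr_rle0 _ (exprn_gt0 2 t0)) -exprMn.
  move: minor kl dll.
  by case: (ord2_cases k) => ->; case: (ord2_cases l) => -> //= + _ dll;
    rewrite dll; lra.
apply: sym_mx2P => //; first by rewrite linearZ /= trmx_delta.
all: move: kl dll; rewrite !mxE.
all: by case: (ord2_cases k) => ->; case: (ord2_cases l) => -> //= _;
  rewrite ?d0 ?mulr0 ?mulr1.
Qed.

(** Pairing with factors supported at the entry [(k, k)] reads off the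
    [(k, k)] entries of the other side, so that the rate at which [A i0] is
    rescaled determines the rate of this entry in all factors. *)
Lemma motion_diag_scaling (R : realType) (p q : nat)
    (A dA : 'I_p -> 'M[R]_2) (B dB : 'I_q -> 'M[R]_2) (i0 : 'I_p) (j0 : 'I_q)
    (k : 'I_2) (x x' y y' : R) :
  (forall i j, dotm (dA i) (B j) + dotm (A i) (dB j) = 0) ->
  x != 0 -> A i0 = x *: delta_mx k k -> dA i0 = x' *: delta_mx k k ->
  y != 0 -> B j0 = y *: delta_mx k k -> dB j0 = y' *: delta_mx k k ->
  exists c, (forall i, dA i k k = c * A i k k) /\
            (forall j, dB j k k = - c * B j k k).
Proof.
move=> eAB x0 Ai0 dAi0 y0 Bj0 dBj0; exists (x' / x).
have dBE j : dB j k k = - (x' / x) * B j k k.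
  have := eAB i0 j; rewrite Ai0 dAi0 !dotm_axis => e.
  apply: (mulfI x0); rewrite [RHS](_ : _ = - (x' / x * x * B j k k)); last ring.
  by rewrite divfK //; lra.
split=> // i; have := eAB i j0.
have := dBE j0; rewrite Bj0 dBj0 dotmC dotm_axis dotmC dotm_axis !mxE !eqxx !mulr1.
move=> -> e; apply: (mulfI y0); lra.
Qed.

Lemma small_slope_ge0 (R : realType) (e u v : R) : 0 < e ->
  (forall t, 0 < t -> t < e -> 0 <= u + t * v) -> 0 <= u.
Proof.
move=> e0 uv; rewrite leNgt; apply/negP => u0.
have v1 : 0 < `|v| + 1 by rewrite ltr_wpDl.
pose t := Num.min (e / 2) (- u / 2 / (`|v| + 1)).
have t0 : 0 < t by rewrite lt_min !divr_gt0 //; lra.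
have te : t < e by rewrite gt_min; apply/orP; left; lra.
have tv : t * (`|v| + 1) <= - u / 2 by rewrite -ler_pdivlMr // ge_min lexx orbT.
have := uv t t0 te; have := ler_wpM2l (ltW t0) (ler_norm v); lra.
Qed.

(** For a singular [X] moved by rates [c0], [c1], [c2] on its entries, the
    expression in the conclusion is [\det (X + t dX) / (t X_01 ^ 2)]. *)
Lemma psd_boundary_scaling (R : realType) (X dX : 'M[R]_2) (c0 c1 c2 t : R) :
  0 < t -> X 0 1 != 0 -> X 0 0 * X 1 1 = X 0 1 ^+ 2 ->
  dX 0 0 = c0 * X 0 0 -> dX 1 1 = c1 * X 1 1 -> dX 0 1 = c2 * X 0 1 ->
  psd (X + t *: dX) -> 0 <= (c0 + c1 - 2 * c2) + t * (c0 * c1 - c2 ^+ 2).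
Proof.
move=> t0 X01 dtX d0 d1 d2 /psd2P[_ _ _]; rewrite !mxE d0 d1 d2.
have w0 : 0 < t * X 0 1 ^+ 2.
  by rewrite mulr_gt0 // lt_def sqrf_eq0 X01 sqr_ge0.
rewrite -(pmulr_rge0 _ w0) -subr_ge0 => /le_trans; apply.
rewrite le_eqVlt; apply/orP; left; rewrite -subr_eq0; apply/eqP.
rewrite [LHS](_ : _ = (1 + t * c0) * (1 + t * c1)
                       * (X 0 0 * X 1 1 - X 0 1 ^+ 2)); last ring.
by rewrite dtX subrr mulr0.
Qed.

(** The coordinate form of rigidity: four factors on the axes diagonalize the
    motion, and one singular factor off the axes on each side makes its three
    rates equal, because the slopes of the determinants on the two sides are
    opposite and both nonnegative. *)
Lemma axis_motion_scaling (R : realType) (p q : nat)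
    (A dA : 'I_p -> 'M[R]_2) (B dB : 'I_q -> 'M[R]_2)
    (i0 i1 i2 : 'I_p) (j0 j1 j2 : 'I_q) (x0 x1 y0 y1 : R) :
  (forall i, psd (A i)) -> (forall j, psd (B j)) -> inf_motion A B dA dB ->
  x0 != 0 -> A i0 = x0 *: delta_mx 0 0 -> x1 != 0 -> A i1 = x1 *: delta_mx 1 1 ->
  y0 != 0 -> B j0 = y0 *: delta_mx 1 1 -> y1 != 0 -> B j1 = y1 *: delta_mx 0 0 ->
  A i2 0 1 != 0 -> A i2 0 0 * A i2 1 1 = A i2 0 1 ^+ 2 ->
  B j2 0 1 != 0 -> B j2 0 0 * B j2 1 1 = B j2 0 1 ^+ 2 ->
  exists c, (forall i, dA i = c *: A i) /\ (forall j, dB j = - c *: B j).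
Proof.
move=> pA pB mAB x0N A0 x1N A1 y0N B0 y1N B1 A2 dA2 B2 dB2.
have mBA := inf_motion_swap mAB.
have n01 : (0 : 'I_2) != 1 by [].
have n10 : (1 : 'I_2) != 0 by [].
have [x0' dA0] := motion_axis (pA i0) (pB j0) mAB n01 A0 B0 y0N.
have [x1' dA1] := motion_axis (pA i1) (pB j1) mAB n10 A1 B1 y1N.
have [y0' dB0] := motion_axis (pB j0) (pA i0) mBA n10 B0 A0 x0N.
have [y1' dB1] := motion_axis (pB j1) (pA i1) mBA n01 B1 A1 x1N.
case: mAB => sA sB eAB [e e0 pAB].
have [c0 [cA0 cB0]] := motion_diag_scaling eAB x0N A0 dA0 y1N B1 dB1.
have [c1 [cA1 cB1]] := motion_diag_scaling eAB x1N A1 dA1 y0N B0 dB0.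
have off i j : dA i 0 1 * B j 0 1 + A i 0 1 * dB j 0 1 = 0.
  have := eAB i j; rewrite !dotm_sym2 //; [|by have [] := pA i|by have [] := pB j].
  by rewrite cA0 cA1 cB0 cB1; lra.
pose c2 := dA i2 0 1 / A i2 0 1.
have dA2E : dA i2 0 1 = c2 * A i2 0 1 by rewrite divfK.
have cB2 j : dB j 0 1 = - c2 * B j 0 1.
  by apply: (mulfI A2); have := off i2 j; rewrite dA2E; lra.
have cA2 i : dA i 0 1 = c2 * A i 0 1.
  by apply: (mulfI B2); have := off i j2; rewrite cB2; lra.
(* The first-order terms for [A i2] and [B j2] are opposite, the second-order
   terms are equal. *)
have uA t : 0 < t -> t < e -> 0 <= (c0 + c1 - 2 * c2) + t * (c0 * c1 - c2 ^+ 2).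
  move=> t0 te; have [/(_ i2) + _] := pAB t (ltW t0) te.
  exact: psd_boundary_scaling.
have uB t : 0 < t -> t < e -> 0 <= (- c0 - c1 + 2 * c2) + t * (c0 * c1 - c2 ^+ 2).
  move=> t0 te; have [_ /(_ j2)] := pAB t (ltW t0) te.
  move/(psd_boundary_scaling t0 B2 dB2 (cB0 j2) (cB1 j2) (cB2 j2)).
  by rewrite mulrNN sqrrN mulrN opprK.
have u0 := small_slope_ge0 e0 uA; have u0' := small_slope_ge0 e0 uB.
have c2E : c2 = (c0 + c1) / 2 by lra.
have t0 : 0 < e / 2 by rewrite divr_gt0.
have te : e / 2 < e by rewrite ltr_pdivrMr //; lra.
(* With [c2] the mean of [c0] and [c1], this is [- ((c0 - c1) / 2) ^ 2 >= 0]. *)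
have v0 : 0 <= c0 * c1 - c2 ^+ 2.
  rewrite -(pmulr_rge0 _ t0); have := uA _ t0 te; lra.
have c01 : c0 = c1.
  apply/eqP; rewrite -subr_eq0 -sqrf_eq0 eq_le sqr_ge0 andbT.
  move: v0; rewrite c2E; lra.
have c02 : c0 = c2 by lra.
exists c0; split=> [i|j]; apply: sym_mx2P; rewrite ?mxE //.
- by rewrite linearZ /=; have [-> _] := pA i.
- by rewrite cA1 -c01.
- by rewrite cA2 -c02.
- by rewrite linearZ /=; have [-> _] := pB j.
- by rewrite cB1 -c01.
- by rewrite cB2 -c02.
Qed.

(** * Frames of the plane *)

Definition frame (R : realType) (x y : 'cV[R]_2) : 'M[R]_2 := row_mx x y.

Lemma frame_col0 (R : realType) (x y : 'cV[R]_2) i : frame x y i 0 = x i 0.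
Proof. by rewrite -(row_mxEl x y i 0); congr (row_mx x y i _); apply: val_inj. Qed.

Lemma frame_col1 (R : realType) (x y : 'cV[R]_2) i : frame x y i 1 = y i 0.
Proof. by rewrite -(row_mxEr x y i 0); congr (row_mx x y i _); apply: val_inj. Qed.

Lemma det2E (R : realType) (x y : 'cV[R]_2) :
  det2 x y = x 0 0 * y 1 0 - y 0 0 * x 1 0.
Proof. by rewrite /det2 -/(frame x y) det_mx2 !frame_col0 !frame_col1. Qed.

Lemma det2C (R : realType) (x y : 'cV[R]_2) : det2 x y = - det2 y x.
Proof. by rewrite !det2E; ring. Qed.

Lemma dotvE (R : realType) (x y : 'cV[R]_2) :
  dotv x y = x 0 0 * y 0 0 + x 1 0 * y 1 0.
Proof. by rewrite /dotv mxE sum_ord2 !mxE. Qed.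

Lemma frame_unit (R : realType) (x y : 'cV[R]_2) :
  det2 x y <> 0 -> frame x y \in unitmx.
Proof. by move=> /eqP d0; rewrite unitmxE unitfE. Qed.

Lemma mul_frame (R : realType) (x y v : 'cV[R]_2) :
  frame x y *m v = v 0 0 *: x + v 1 0 *: y.
Proof.
apply/colP => i; rewrite !mxE sum_ord2 frame_col0 frame_col1.
by rewrite mulrC [_ * v 1 0]mulrC.
Qed.

Lemma mulmx_frame (R : realType) (g : 'M[R]_2) (x y : 'cV[R]_2) :
  g *m frame x y = frame (g *m x) (g *m y).
Proof. exact: (mul_mx_row g x y). Qed.

Lemma tr_frame_mul0 (R : realType) (x y v : 'cV[R]_2) :
  ((frame x y)^T *m v) 0 0 = dotv x v.
Proof. by rewrite dotvE mxE sum_ord2 ![_^T _ _]mxE !frame_col0. Qed.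

Lemma tr_frame_mul1 (R : realType) (x y v : 'cV[R]_2) :
  ((frame x y)^T *m v) 1 0 = dotv y v.
Proof. by rewrite dotvE mxE sum_ord2 ![_^T _ _]mxE !frame_col1. Qed.

Lemma dotv_frame_eq0 (R : realType) (x y v : 'cV[R]_2) :
  det2 x y <> 0 -> dotv x v = 0 -> dotv y v = 0 -> v = 0.
Proof.
move=> xy xv yv; have uF : (frame x y)^T \in unitmx by rewrite unitmx_tr frame_unit.
rewrite -(mulKmx uF v) [_ *m v](_ : _ = 0) ?mulmx0 //; apply/colP => i.
by case: (ord2_cases i) => ->; rewrite ?tr_frame_mul0 ?tr_frame_mul1 mxE.
Qed.

Lemma dotvC (R : realType) (x y : 'cV[R]_2) : dotv x y = dotv y x.
Proof. by rewrite !dotvE; ring. Qed.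

(** In the plane, the vectors orthogonal to a nonzero [x] form a line, here the
    line of [y], which does not contain [y']. *)
Lemma dotv_orthogonal_neq0 (R : realType) (x x' y y' : 'cV[R]_2) :
  det2 x x' <> 0 -> det2 y y' <> 0 -> dotv x y = 0 -> dotv x y' <> 0.
Proof.
move=> xx' yy' xy xy'; apply: xx'.
rewrite (dotv_frame_eq0 yy' (v := x)) ?(dotvC _ x) //.
by rewrite det2E !mxE mul0r mulr0 subr0.
Qed.

Lemma outer_axis (R : realType) (v : 'cV[R]_2) (k l : 'I_2) : k != l ->
  v l 0 = 0 -> v *m v^T = (v k 0 ^+ 2) *: delta_mx k k.
Proof.
move=> kl vl; apply/matrixP => i j; rewrite !mxE big_ord1 !mxE.
have vE m : v m 0 = v k 0 * (m == k)%:R.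
  case: eqVneq => [->|mk]; rewrite ?mulr1 // mulr0 -vl; congr (v _ 0).
  by move: kl mk; case: (ord2_cases k) => ->; case: (ord2_cases l) => ->;
    case: (ord2_cases m) => ->.
rewrite (vE i) (vE j).
by case: (i == k); case: (j == k); rewrite /= ?mulr0 ?mul0r ?mulr1.
Qed.

(** * Rigidity from three rank-one factors on either side *)

(** The congruence by the inverse of the frame [a0], [a1] moves the two
    orthogonal pairs to the coordinate axes; on the B side it is the congruence
    by the transposed frame, whose entries are the products [dotv a_k b]. The
    determinant conditions say that the third factors are off the axes. *)
Lemma motion_scaling_of_three (R : realType) (p q : nat)
    (A dA : 'I_p -> 'M[R]_2) (B dB : 'I_q -> 'M[R]_2)
    (i0 i1 i2 : 'I_p) (j0 j1 j2 : 'I_q) (a0 a1 a2 b0 b1 b2 : 'cV[R]_2) :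
  (forall i, psd (A i)) -> (forall j, psd (B j)) -> inf_motion A B dA dB ->
  A i0 = a0 *m a0^T -> A i1 = a1 *m a1^T -> A i2 = a2 *m a2^T ->
  B j0 = b0 *m b0^T -> B j1 = b1 *m b1^T -> B j2 = b2 *m b2^T ->
  dotv a0 b0 = 0 -> dotv a1 b1 = 0 ->
  det2 a0 a1 <> 0 -> det2 a2 a0 <> 0 -> det2 a2 a1 <> 0 ->
  det2 b0 b1 <> 0 -> det2 b0 b2 <> 0 -> det2 b1 b2 <> 0 ->
  exists c, (forall i, dA i = c *: A i) /\ (forall j, dB j = - c *: B j).
Proof.
move=> pA pB mAB A0 A1 A2 B0 B1 B2 ab0 ab1 a01 a20 a21 b01 b02 b12.
have a10 : det2 a1 a0 <> 0 by rewrite det2C; apply/eqP; rewrite oppr_eq0; apply/eqP.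
have b10 : det2 b1 b0 <> 0 by rewrite det2C; apply/eqP; rewrite oppr_eq0; apply/eqP.
have n01 : (0 : 'I_2) != 1 by [].
have n10 : (1 : 'I_2) != 0 by [].
pose h := frame a0 a1; have uh : h \in unitmx by exact: frame_unit.
pose g := invmx h; have ug : g \in unitmx by rewrite unitmx_inv.
have gT : (invmx g)^T = h^T by rewrite invmxK.
have ga0 : g *m a0 = delta_mx 0 0.
  rewrite -(mulKmx uh (delta_mx 0 0)) mul_frame !mxE /=.
  by rewrite scale1r scale0r addr0.
have ga1 : g *m a1 = delta_mx 1 0.
  rewrite -(mulKmx uh (delta_mx 1 0)) mul_frame !mxE /=.
  by rewrite scale1r scale0r add0r.
have a2E : a2 = (g *m a2) 0 0 *: a0 + (g *m a2) 1 0 *: a1.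
  by rewrite -mul_frame mulKVmx.
have [x2 y2] : (g *m a2) 0 0 != 0 /\ (g *m a2) 1 0 != 0.
  split; apply/eqP => z; [apply: a21|apply: a20]; rewrite a2E z det2E !mxE; ring.
have off (u : 'cV[R]_2) i j : (u *m u^T) i j = u i 0 * u j 0.
  by rewrite mxE big_ord1 mxE.
have [c [cA cB]] : exists c,
    (forall i, cong g (dA i) = c *: cong g (A i)) /\
    (forall j, cong h^T (dB j) = - c *: cong h^T (B j)).
  have := inf_motion_cong ug mAB; rewrite gT => mot.
  apply: (axis_motion_scaling (i0 := i0) (i1 := i1) (i2 := i2) (j0 := j0)
    (j1 := j1) (j2 := j2) (x0 := 1) (x1 := 1) (y0 := dotv a1 b0 ^+ 2)
    (y1 := dotv a0 b1 ^+ 2) _ _ mot) => [i|j||||||||||||] /=; rewrite ?oner_neq0 //.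
  - exact: psd_cong.
  - exact: psd_cong.
  - by rewrite A0 cong_rank1 ga0 (outer_axis n01) !mxE ?expr1n.
  - by rewrite A1 cong_rank1 ga1 (outer_axis n10) !mxE ?expr1n.
  - by rewrite sqrf_eq0; apply/eqP/(dotv_orthogonal_neq0 a10 b10 ab1).
  - by rewrite B0 cong_rank1 (outer_axis n10) ?tr_frame_mul0 ?tr_frame_mul1.
  - by rewrite sqrf_eq0; apply/eqP/(dotv_orthogonal_neq0 a01 b01 ab0).
  - by rewrite B1 cong_rank1 (outer_axis n01) ?tr_frame_mul0 ?tr_frame_mul1.
  - by rewrite A2 cong_rank1 off mulf_neq0.
  - by rewrite A2 cong_rank1 !off; ring.
  - rewrite B2 cong_rank1 off tr_frame_mul0 tr_frame_mul1 mulf_neq0 //; apply/eqP.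
      exact: (dotv_orthogonal_neq0 a01 b02 ab0).
    exact: (dotv_orthogonal_neq0 a10 b12 ab1).
  - by rewrite B2 cong_rank1 !off; ring.
exists c; split=> [i|j].
  by apply: (can_inj (congK ug)); rewrite linearZ.
have uhT : h^T \in unitmx by rewrite unitmx_tr.
by apply: (can_inj (congK uhT)); rewrite linearZ.
Qed.

Lemma vec_is_linear (R : realType) : linear (@vec R).
Proof.
move=> c X Y; apply/rowP => l; rewrite !mxE.
by case: l => [[|[|[|]]] ?] //=; ring.
Qed.

HB.instance Definition _ (R : realType) :=
  GRing.isLinear.Build R 'M[R]_2 'rV[R]_3 _ (@vec R) (@vec_is_linear R).

Lemma scaling_motion (R : realType) (p q : nat)
    (A : 'I_p -> 'M[R]_2) (B : 'I_q -> 'M[R]_2) (c : R) :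
  (forall i, psd (A i)) -> (forall j, psd (B j)) ->
  inf_motion A B (fun i => c *: A i) (fun j => - c *: B j).
Proof.
move=> pA pB; split=> [i|j|i j|].
- by rewrite linearZ /=; have [-> _] := pA i.
- by rewrite linearZ /=; have [-> _] := pB j.
- by rewrite /dotm -scalemxAl -scalemxAr !mxtraceZ; ring.
have c1 : 0 < `|c| + 1 by rewrite ltr_wpDl.
exists (`|c| + 1)^-1; first by rewrite invr_gt0.
move=> t t0 tc; have tc1 : t * (`|c| + 1) < 1 by rewrite -ltr_pdivlMr // mul1r.
have [tc' tc''] : 0 <= 1 + t * c /\ 0 <= 1 + t * - c.
  have := ler_wpM2l t0 (ler_norm c); have := ler_wpM2l t0 (ler_norm (- c)).
  by rewrite normrN; lra.
by split=> [i|j]; rewrite scalerA -[X in X + _]scale1r -scalerDl; apply: psdZ.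
Qed.

(** Scalings do not refer to the factors, so the matrix [c%:M] induces a motion
    of any tuple of psd matrices. *)
Lemma scaling_trivial (R : realType) (p q : nat)
    (A dA : 'I_p -> 'M[R]_2) (B dB : 'I_q -> 'M[R]_2) (c : R) :
  (forall i, dA i = c *: A i) -> (forall j, dB j = - c *: B j) ->
  trivial_motion A B dA dB.
Proof.
have scal (X : 'M[R]_2) : vec (c *: X) = vec X *m c%:M.
  by rewrite linearZ mul_mx_scalar.
have scalT (X : 'M[R]_2) : (vec (- c *: X))^T = - c%:M *m (vec X)^T.
  by rewrite linearZ /= linearZ /= mulNmx mul_scalar_mx scaleNr.
move=> dAE dBE; exists c%:M; first by split=> [i|j]; rewrite ?dAE ?dBE.
move=> M' A' B' _ [pA pB _].
by exists (fun i => c *: A' i), (fun j => - c *: B' j); split=> //; apply: scaling_motion.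
Qed.

(** * Nontrivial motions *)

(** The bases [a0], [a1] and [b1], [b0] are dual up to scalars, so the transpose
    of the reflection along [a1] is the reflection along [b0]. *)
Lemma ex_reflection (R : realType) (a0 a1 b0 b1 : 'cV[R]_2) :
  det2 a0 a1 <> 0 -> dotv a0 b0 = 0 -> dotv a1 b1 = 0 ->
  exists r : 'M[R]_2, [/\ r *m a0 = a0, r *m a1 = - a1,
                          r^T *m b0 = - b0 & r^T *m b1 = b1].
Proof.
move=> a01 ab0 ab1; have uF := frame_unit a01.
pose r := frame a0 (- a1) *m invmx (frame a0 a1).
have ra0 : r *m a0 = a0.
  have aE : a0 = frame a0 a1 *m delta_mx 0 0.
    by rewrite mul_frame !mxE scale1r scale0r addr0.
  by rewrite {1}aE mulmxA mulmxKV // mul_frame !mxE scale1r scale0r addr0.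
have ra1 : r *m a1 = - a1.
  have aE : a1 = frame a0 a1 *m delta_mx 1 0.
    by rewrite mul_frame !mxE scale1r scale0r add0r.
  by rewrite {1}aE mulmxA mulmxKV // mul_frame !mxE scale1r scale0r add0r.
have adj x y : dotv x (r^T *m y) = dotv (r *m x) y.
  by rewrite /dotv [(r *m x)^T]trmx_mul mulmxA.
have dotvB (x y z : 'cV[R]_2) : dotv x (y - z) = dotv x y - dotv x z.
  by rewrite !dotvE !mxE; ring.
have dotvN (x y : 'cV[R]_2) : dotv (- x) y = - dotv x y.
  by rewrite !dotvE !mxE; ring.
have dotvNr (x y : 'cV[R]_2) : dotv x (- y) = - dotv x y.
  by rewrite !dotvE !mxE; ring.
exists r; split=> //; apply/eqP; rewrite -subr_eq0; apply/eqP/(dotv_frame_eq0 a01).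
- by rewrite dotvB adj ra0 dotvNr ab0 oppr0 subrr.
- by rewrite dotvB adj ra1 dotvNr dotvN subrr.
- by rewrite dotvB adj ra0 subrr.
- by rewrite dotvB adj ra1 dotvN ab1 oppr0 addr0.
Qed.

(** The matrix [M] is the product of the matrices with rows [vec (A i)] and
    columns [vec (B j)], whose inner dimension is three; so rank three makes the
    [A i] span the symmetric matrices. Hence the values on the [A i] determine
    the matrix [D] of a motion. *)
Lemma sym_span (R : realType) (p q : nat) (M : 'M[R]_(p, q))
    (A : 'I_p -> 'M[R]_2) (B : 'I_q -> 'M[R]_2) (X : 'M[R]_2) :
  \rank M = 3%N -> psd_factorization M A B -> X^T = X ->
  exists u : 'rV[R]_p, X = \sum_i u 0 i *: A i.
Proof.
move=> rM [pA pB MAB] sX.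
have vec_inj (Y : 'M[R]_2) : Y^T = Y -> vec X = vec Y -> X = Y.
  move=> sY /rowP e; apply: sym_mx2P => //.
  - by have := e 0; rewrite !mxE.
  - by have := e 1; rewrite !mxE.
  have := e 2; rewrite !mxE /=; apply: mulfI.
  by rewrite sqrtr_eq0 -ltNge.
pose VA := \matrix_i vec (A i); pose VB := \matrix_j vec (B j).
have MV : M = VA *m VB^T.
  apply/matrixP => i j; rewrite MAB.
  have [sA _] := pA i; have [sB _] := pB j.
  rewrite (dotm_sym2 sA sB) mxE !big_ord_recl big_ord0 !mxE /=.
  rewrite -[2 in LHS](sqr_sqrtr (ler0n R 2)); ring.
have fA : row_full VA.
  rewrite /row_full eqn_leq rank_leq_col /=.
  by move: (mxrankM_maxl VA VB^T); rewrite -MV rM.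
have /submxP[u uX] := submx_full (vec X) fA.
exists u; apply: vec_inj.
  rewrite linear_sum; apply: eq_bigr => i _; rewrite linearZ /=.
  by have [-> _] := pA i.
rewrite uX mulmx_sum_row linear_sum; apply: eq_bigr => i _.
by rewrite linearZ rowK.
Qed.

(** By [sym_span], [D] sends every symmetric [X] to [s (r X r^T - X)]. The
    congruence [g] takes [a0] to [x := a0 + a1] and [b0] to some [y] orthogonal
    to [x]. If [D] moved the transformed factorization, [motion_orthogonal]
    would give [<s (z z^T - x x^T), y y^T> = 0] with [z := r x = a0 - a1], so
    that [y] would be orthogonal to both [x] and [z], which span the plane. *)
Lemma reflection_not_trivial (R : realType) (p q : nat) (M : 'M[R]_(p, q))
    (A dA : 'I_p -> 'M[R]_2) (B dB : 'I_q -> 'M[R]_2) (i0 : 'I_p) (j0 : 'I_q)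
    (a0 a1 b0 : 'cV[R]_2) (r : 'M[R]_2) (s : R) :
  M32 M -> psd_factorization M A B -> A i0 = a0 *m a0^T -> B j0 = b0 *m b0^T ->
  dotv a0 b0 = 0 -> det2 a0 a1 <> 0 -> b0 <> 0 ->
  r *m a0 = a0 -> r *m a1 = - a1 -> s != 0 ->
  (forall i, dA i = s *: (cong r (A i) - A i)) -> ~ trivial_motion A B dA dB.
Proof.
move=> hM fAB A0 B0 ab0 a01 b0N ra0 ra1 sN dAE [D [vA _] univ].
have [_ rM _] := hM.
have DE X : X^T = X -> vec (s *: (cong r X - X)) = vec X *m D.
  move=> sX; have [u ->] := sym_span rM fAB sX.
  rewrite linear_sum -sumrB scaler_sumr !linear_sum mulmx_suml.
  apply: eq_bigr => i _.
  rewrite /= [vec (u 0 i *: A i)]linearZ /= -scalemxAl -vA dAE -linearZ /=; congr vec.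
  by rewrite [cong r (u 0 i *: A i)]linearZ /= -scalerBr !scalerA mulrC.
pose h := frame a0 a1; have uh : h \in unitmx by exact: frame_unit.
pose g := frame (a0 + a1) a1 *m invmx h.
have ug : g \in unitmx.
  rewrite unitmx_mul unitmx_inv uh andbT frame_unit //.
  by move=> d; apply: a01; move: d; rewrite !det2E !mxE; lra.
have ga0 : g *m a0 = a0 + a1.
  have a0E : a0 = h *m delta_mx 0 0.
    by rewrite mul_frame !mxE scale1r scale0r addr0.
  by rewrite {1}a0E mulmxA mulmxKV // mul_frame !mxE scale1r scale0r addr0.
pose A' i := cong g (A i); pose B' j := cong (invmx g)^T (B j).
have fA'B' : psd_factorization M A' B' by exact: psd_factorization_cong.
have [dA' [dB' [[vA' _] mot]]] := univ M A' B' hM fA'B'.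
have [pA' pB' MAB'] := fA'B'.
pose x := a0 + a1; pose z := a0 - a1; pose y := (invmx g)^T *m b0.
have A'0 : A' i0 = x *m x^T by rewrite /A' A0 cong_rank1 ga0.
have B'0 : B' j0 = y *m y^T by rewrite /B' B0 cong_rank1.
have dot_outer (u v : 'cV[R]_2) : dotm (u *m u^T) (v *m v^T) = dotv u v ^+ 2.
  rewrite /dotm mulmxA mxtrace_mulC !mulmxA -mulmxA [u^T *m v]mx11_scalar.
  by rewrite mul_mx_scalar mxtraceZ [in RHS]expr2 /mxtrace big_ord1 -/(dotv v u) dotvC.
have AB'0 : dotm (A' i0) (B' j0) = 0.
  by rewrite dotm_cong_contra // A0 B0 dot_outer ab0 expr0n.
have := motion_orthogonal (pA' i0) (pB' j0) mot AB'0.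
have -> : dA' i0 = s *: (z *m z^T - x *m x^T).
  have rx : r *m x = z by rewrite mulmxDr ra0 ra1.
  have [sA' _] := pA' i0; have [symdA _ _ _] := mot.
  have := DE _ sA'; rewrite -vA' /A' -/(A' i0) A'0 cong_rank1 rx => /rowP e.
  apply: sym_mx2P.
  - exact: symdA.
  - by rewrite linearZ linearB /= !trmx_mul !trmxK.
  - by have := e 0; rewrite !mxE.
  - by have := e 1; rewrite !mxE.
  have := e 2; rewrite !mxE /=; move/mulfI => -> //.
  by rewrite sqrtr_eq0 -ltNge.
rewrite B'0 {1}/dotm -scalemxAl mxtraceZ mulmxBl linearB /= -!/(dotm _ _).
rewrite !dot_outer.
have xy : dotv x y = 0.
  by apply/eqP; rewrite -sqrf_eq0 -dot_outer -A'0 -B'0 AB'0.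
rewrite xy expr0n subr0 => /eqP; rewrite mulf_eq0 (negbTE sN) sqrf_eq0 /= => /eqP zy.
have xz : det2 x z <> 0.
  by move=> d; apply: a01; move: d; rewrite !det2E !mxE; lra.
apply: b0N; have ugT : (invmx g)^T \in unitmx by rewrite unitmx_tr unitmx_inv.
by rewrite -(mulKmx ugT b0) -/y (dotv_frame_eq0 xz xy zy) mulmx0.
Qed.

Lemma small_quadratic_ge0 (R : realType) (c m n : R) : 0 < c ->
  exists2 e, 0 < e & forall t, 0 <= t -> t < e -> 0 <= c + t * m + t ^+ 2 * n.
Proof.
move=> c0; have mn : 0 < `|m| + `|n| + 1 by rewrite ltr_wpDl // addr_ge0.
exists (Num.min 1 (c / (`|m| + `|n| + 1))); first by rewrite lt_min ltr01 divr_gt0.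
move=> t t0; rewrite lt_min => /andP[t1]; rewrite ltr_pdivlMr // => tc.
have := ler_wpM2l t0 (ler_norm (- m)).
have := ler_wpM2l (sqr_ge0 t) (ler_norm (- n)).
have := mulr_ge0 (mulr_ge0 t0 (normr_ge0 n)) (ltW (etrans (subr_gt0 _ _) t1)).
rewrite !normrN; lra.
Qed.

Lemma uniform_small (R : realType) (n : nat) (P : 'I_n -> R -> Prop) :
  (forall i, exists2 e, 0 < e & forall t, 0 <= t -> t < e -> P i t) ->
  exists2 e, 0 < e & forall t, 0 <= t -> t < e -> forall i, P i t.
Proof.
move=> /fin_all_exists2[e e0 eP]; exists (\big[Num.min/1]_i e i).
  by apply: (big_ind (fun x => 0 < x)) => // x y x0 y0; rewrite lt_min x0.
move=> t t0 te i; apply: eP => //; apply: lt_le_trans te _.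
exact: bigmin_le_cond.
Qed.

(** A nonsingular psd matrix is interior to the cone, which leaves room in any
    direction; a singular one is zero or of rank one, and then the direction
    vanishes. *)
Lemma psd_extrapolation (R : realType) (Y s : 'M[R]_2) :
  psd Y -> (\rank Y = 1%N -> cong s Y = Y) ->
  exists2 e, 0 < e & forall t, 0 <= t -> t < e -> psd (Y + t *: (Y - cong s Y)).
Proof.
move=> pY sY; have /psd2P[symY Y0 Y1 dY] := pY.
have [d0|dN] := eqVneq (\det Y) 0.
  have -> : cong s Y = Y.
    have [->|/eqP YN] := eqVneq Y 0; first by rewrite linear0.
    exact/sY/det_psd_eq0_rank1.
  by exists 1 => // t _ _; rewrite subrr scaler0 addr0.
have dP : 0 < Y 0 0 * Y 1 1 - Y 0 1 ^+ 2.
  by rewrite lt_def subr_ge0 dY andbT; move: dN; rewrite det_mx2 (sym_entry symY).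
have Y0P : 0 < Y 0 0.
  rewrite lt_def Y0 andbT; apply/eqP => z; move: dP; rewrite z mul0r sub0r oppr_gt0.
  by rewrite ltNge sqr_ge0.
have Y1P : 0 < Y 1 1.
  rewrite lt_def Y1 andbT; apply/eqP => z; move: dP; rewrite z mulr0 sub0r oppr_gt0.
  by rewrite ltNge sqr_ge0.
set Z := Y - cong s Y.
have symZ : Z^T = Z by rewrite linearB /= symY cong_sym.
have [e0 e0P h0] := small_quadratic_ge0 (Z 0 0) 0 Y0P.
have [e1 e1P h1] := small_quadratic_ge0 (Z 1 1) 0 Y1P.
(* The expansion of [\det (Y + t *: Z)] in [t]. *)
have [e2 e2P h2] := small_quadratic_ge0
  (Y 0 0 * Z 1 1 + Y 1 1 * Z 0 0 - 2 * (Y 0 1 * Z 0 1))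
  (Z 0 0 * Z 1 1 - Z 0 1 ^+ 2) dP.
exists (Num.min e0 (Num.min e1 e2)); first by rewrite !lt_min e0P e1P.
move=> t t0; rewrite !lt_min => /and3P[te0 te1 te2].
apply/psd2P; rewrite !mxE; split.
- by rewrite linearD linearZ /= symY symZ.
- by have := h0 t t0 te0; rewrite mulr0 addr0 !mxE.
- by have := h1 t t0 te1; rewrite mulr0 addr0 !mxE.
by have := h2 t t0 te2; rewrite !mxE; lra.
Qed.

(** The bilinear condition holds for any [r], since [cong r] and [cong r^T] are
    adjoint. One side moves towards a psd matrix and stays in the cone by
    convexity; the other side moves away from one, and the hypothesis protects
    exactly the factors that would leave the cone. *)
Lemma reflection_motion (R : realType) (p q : nat)
    (A : 'I_p -> 'M[R]_2) (B : 'I_q -> 'M[R]_2) (r : 'M[R]_2) :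
  (forall i, psd (A i)) -> (forall j, psd (B j)) ->
  (forall j, \rank (B j) = 1%N -> cong r^T (B j) = B j) ->
  inf_motion A B (fun i => cong r (A i) - A i) (fun j => B j - cong r^T (B j)).
Proof.
move=> pA pB rB; split=> [i|j|i j|].
- by have [sA _] := pA i; rewrite linearB /= cong_sym // sA.
- by have [sB _] := pB j; rewrite linearB /= cong_sym // sB.
- have := dotm_cong r (A i) (B j).
  rewrite /dotm mulmxBl mulmxBr !linearB /= => ->; ring.
have [e e0 eB] := uniform_small (fun j => psd_extrapolation (pB j) (rB j)).
exists (Num.min 1 e); first by rewrite lt_min ltr01.
move=> t t0; rewrite lt_min => /andP[t1 te]; split=> [i|j]; last exact: eB.
rewrite (_ : _ + _ = (1 - t) *: A i + t *: cong r (A i)); last first.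
  by rewrite scalerBr scalerBl scale1r [RHS]addrAC addrA.
by apply: psdD; apply: psdZ => //; [rewrite subr_ge0 ltW|apply: psd_cong].
Qed.

(** * The rigidity criterion *)

Theorem theorem6 (R : realType) (p q : nat) (M : 'M[R]_(p, q))
    (A : 'I_p -> 'M[R]_2) (B : 'I_q -> 'M[R]_2)
    (hM : M32 M) (hAB : psd_factorization M A B)
    (pbar qbar : nat) (hp : (pbar <= p)%N) (hq : (qbar <= q)%N)
    (rkA : forall i : 'I_p, \rank (A i) = 1%N <-> (i < pbar)%N)
    (rkB : forall j : 'I_q, \rank (B j) = 1%N <-> (j < qbar)%N)
    (a : 'I_pbar -> 'cV[R]_2) (b : 'I_qbar -> 'cV[R]_2)
    (hA : forall i : 'I_pbar, A (widen_ord hp i) = a i *m (a i)^T)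
    (hB : forall j : 'I_qbar, B (widen_ord hq j) = b j *m (b j)^T)
    (p2 : (2 <= pbar)%N) (q2 : (2 <= qbar)%N)
    (ab1 : dotv (a (Ordinal (ltnW p2))) (b (Ordinal (ltnW q2))) = 0)
    (ab2 : dotv (a (Ordinal p2)) (b (Ordinal q2)) = 0)
    (deta : forall i j : 'I_pbar, i != j -> det2 (a i) (a j) <> 0)
    (detb : forall i j : 'I_qbar, i != j -> det2 (b i) (b j) <> 0) :
  inf_rigid A B <-> (3 <= pbar)%N /\ (3 <= qbar)%N.
Proof.
have [pA pB _] := hAB.
pose i0 := Ordinal (ltnW p2); pose i1 := Ordinal p2.
pose j0 := Ordinal (ltnW q2); pose j1 := Ordinal q2.
split=> [rigid|[p3 q3] dA dB mot]; last first.
  pose i2 := Ordinal p3; pose j2 := Ordinal q3.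
  have [c [cA cB]] := motion_scaling_of_three pA pB mot
    (hA i0) (hA i1) (hA i2) (hB j0) (hB j1) (hB j2) ab1 ab2
    (deta i0 i1 isT) (deta i2 i0 isT) (deta i2 i1 isT)
    (detb j0 j1 isT) (detb j0 j2 isT) (detb j1 j2 isT).
  exact: scaling_trivial cA cB.
have a01 := deta i0 i1 isT.
have b0N : b j0 <> 0.
  by move=> z; apply: (detb j0 j1 isT); rewrite z det2E !mxE mul0r mulr0 subrr.
have [r [ra0 ra1 rb0 rb1]] := ex_reflection a01 ab1 ab2.
have not_trivial s dA dB : s != 0 ->
    (forall i, dA i = s *: (cong r (A i) - A i)) -> ~ trivial_motion A B dA dB.
  exact: (reflection_not_trivial hM hAB (hA i0) (hB j0) ab1 a01 b0N ra0 ra1).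
have two (n m : nat) (k : 'I_n) (le_mn : (m <= n)%N) (lt1m : (1 < m)%N) :
    ~~ (2 < m)%N -> (k < m)%N ->
    k = widen_ord le_mn (Ordinal (ltnW lt1m)) \/ k = widen_ord le_mn (Ordinal lt1m).
  rewrite -leqNgt => m2 km; have : (k < 2)%N by exact: leq_trans km m2.
  by case: k {km} => [[|[|]]] // ltk _; [left|right]; apply: val_inj.
split; apply/negPn/negP => few; last first.
  have rB j : \rank (B j) = 1%N -> cong r^T (B j) = B j.
    move=> /rkB /(two _ _ _ hq q2 few)[] ->; rewrite hB cong_rank1.
      by rewrite rb0 linearN mulNmx mulmxN opprK.
    by rewrite rb1.
  (* Two rank-one factors on the B side: the A side moves inwards. *)
  apply: (not_trivial 1 _ _ (oner_neq0 _) _ (rigid _ _ (reflection_motion pA pB rB))).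
  by move=> i; rewrite scale1r.
have rA i : \rank (A i) = 1%N -> cong r^T^T (A i) = A i.
  move=> /rkA /(two _ _ _ hp p2 few)[] ->; rewrite trmxK hA cong_rank1.
    by rewrite ra0.
  by rewrite ra1 linearN mulNmx mulmxN opprK.
(* Two rank-one factors on the A side: the roles of the two sides are
   exchanged, and the A side moves outwards. *)
have mot := inf_motion_swap (reflection_motion pB pA rA).
apply: (not_trivial (-1) _ _ _ _ (rigid _ _ mot)) => [|i].
  by rewrite oppr_eq0 oner_neq0.
by rewrite trmxK scaleN1r opprB.
Qed.
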